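(* The number $t_n$ of rays of the submodular cone $\mathbb{SC}_n$ satisfies $t_n\ge 11^{2^{n-4}}$ for all $n\ge 4$ and $t_n\ge 656^{2^{n-5}}$ for all $n\ge 5$.
   Context: A set function $f:2^{[n]}\to\mathbb{R}$ is submodular if $f(A)+f(B)\ge f(A\cup B)+f(A\cap B)$ for all $A,B\subseteq[n]$. The submodular cone $\mathbb{SC}_n$ is the cone of submodular functions $f:2^{[n]}\to\mathbb{R}$; its rays are counted after quotienting by modular functions (i.e. rays of the pointed cone obtained by quotienting by the lineality space). Equivalently, $\mathbb{SC}_n$ is the cone (under Minkowski sum and dilation) of deformed $n$-permutahedra, i.e. polytopes in $\mathbb{R}^n$ all of whose edges are parallel to vectors $e_i-e_j$, with lineality space given by translations; rays correspond to deformed $n$-permutahedra that are not points and are Minkowski indecomposable ($P=Q+R$ implies that $Q$ and $R$ are translated dilates of $P$), up to translation and positive dilation. *)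

(* Defs.v *)
From HB Require Import structures.
From mathcomp Require Import all_boot all_order all_algebra.
From mathcomp Require Import generic_quotient ring_quotient finmap.
From mathcomp Require Import boolp classical_sets cardinality reals.

Set Implicit Arguments.
Unset Strict Implicit.
Unset Printing Implicit Defensive.

Import Order.TTheory GRing.Theory Num.Theory.
Local Open Scope ring_scope.
Local Open Scope quotient_scope.
Local Open Scope classical_set_scope.

(* The quotient V / L of a module by a submodule: ring_quotient only provides
   quotients of additive groups, by a zmodClosed predicate. *)
Section ModuleQuotient.
Variables (R : nzRingType) (V : lmodType R) (L : submodClosed V).

Definition submod_pred : {pred V} := fun x => x \in L.

Lemma submod_pred_zmod_closed : zmod_closed submod_pred.
Proof. exact: GRing.submod_closedB (submodClosedP L). Qed.

HB.instance Definition _ :=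
  GRing.isZmodClosed.Build V submod_pred submod_pred_zmod_closed.

Definition mod_quot := Quotient.quot submod_pred.

HB.instance Definition _ := GRing.Zmodule.on mod_quot.
HB.instance Definition _ := Quotient.on mod_quot.

Definition mod_proj (x : V) : mod_quot := \pi_(Quotient.quot submod_pred) x.

Lemma mod_projE x y : (mod_proj x == mod_proj y) = (x - y \in L).
Proof. by rewrite -[RHS]/(x - y \in submod_pred) Quotient.idealrBE. Qed.

Lemma mod_projD x y : mod_proj (x + y) = mod_proj x + mod_proj y.
Proof. exact: raddfD. Qed.

Lemma mod_proj_repr (q : mod_quot) : mod_proj (repr q) = q.
Proof. exact: reprK. Qed.

Definition mod_quot_scale (a : R) (q : mod_quot) : mod_quot :=
  mod_proj (a *: repr q).

Lemma mod_quot_scaleE a x : mod_quot_scale a (mod_proj x) = mod_proj (a *: x).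
Proof.
apply/eqP; rewrite mod_projE -scalerBr rpredZ// -mod_projE.
by rewrite mod_proj_repr.
Qed.

Lemma mod_quot_scaleA a b q :
  mod_quot_scale a (mod_quot_scale b q) = mod_quot_scale (a * b) q.
Proof. by rewrite -[q]mod_proj_repr !mod_quot_scaleE scalerA. Qed.

Lemma mod_quot_scale1 : left_id 1 mod_quot_scale.
Proof. by move=> q; rewrite -[q]mod_proj_repr mod_quot_scaleE scale1r. Qed.

Lemma mod_quot_scaleDr : right_distributive mod_quot_scale +%R.
Proof.
move=> a p q; rewrite -[p]mod_proj_repr -[q]mod_proj_repr -mod_projD.
by rewrite !mod_quot_scaleE -mod_projD scalerDr.
Qed.

Lemma mod_quot_scaleDl q : {morph mod_quot_scale^~ q : a b / a + b}.
Proof.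
by move=> a b; rewrite -[q]mod_proj_repr !mod_quot_scaleE -mod_projD scalerDl.
Qed.

HB.instance Definition _ := GRing.Zmodule_isLmodule.Build R mod_quot
  mod_quot_scaleA mod_quot_scale1 mod_quot_scaleDr mod_quot_scaleDl.

End ModuleQuotient.

(* The one-dimensional faces of a pointed convex cone C. *)
Definition extreme_ray (R : numDomainType) (V : lmodType R) (C r : set V) :=
  exists2 x : V, C x /\ x != 0 &
    [/\ r = [set a *: x | a in [set a : R | 0 <= a]],
        r `<=` C &
        forall y z, C y -> C z -> r (y + z) -> r y /\ r z].

Section SubmodularCone.
Variables (R : realType) (n : nat).

(* R^o is R as a module over itself, so that set_fun is an R-vector space. *)
Definition set_fun := {ffun {set 'I_n} -> R^o}.
HB.instance Definition _ := GRing.Lmodule.on set_fun.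

Definition submodular : {pred set_fun} := fun f =>
  [forall A : {set 'I_n}, forall B : {set 'I_n},
    f (A :|: B) + f (A :&: B) <= f A + f B].

Definition modular : {pred set_fun} := fun f =>
  [forall A : {set 'I_n}, forall B : {set 'I_n},
    f (A :|: B) + f (A :&: B) == f A + f B].

Lemma submodularP (f : set_fun) : reflect
  (forall A B, f (A :|: B) + f (A :&: B) <= f A + f B) (f \in submodular).
Proof. by apply: (iffP forallP) => fP A; apply/forallP. Qed.

Lemma modularP (f : set_fun) : reflect
  (forall A B, f (A :|: B) + f (A :&: B) = f A + f B) (f \in modular).
Proof.
apply: (iffP forallP) => fP A => [B|]; first by have /forallP/(_ B)/eqP := fP A.
by apply/forallP => B; rewrite fP.
Qed.

Lemma modular_submod_closed : submod_closed modular.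
Proof.
split=> [|a f g /modularP fP /modularP gP]; apply/modularP => A B.
  by rewrite !ffunE.
by rewrite !ffunE addrACA -scalerDr fP gP scalerDr addrACA.
Qed.

HB.instance Definition _ :=
  GRing.isSubmodClosed.Build R set_fun modular (GRing.submod_closed_semi modular_submod_closed).

Lemma modular_lineality (f : set_fun) :
  (f \in modular) = (f \in submodular) && (- f \in submodular).
Proof.
apply/modularP/andP => [fP|[/submodularP fP /submodularP NfP] A B].
  by split; apply/submodularP => A B; rewrite ?ffunE -?opprD fP.
apply/eqP; rewrite eq_le fP/= -lerN2.
by have := NfP A B; rewrite !ffunE -!opprD.
Qed.

Definition submodular_cone : set (mod_quot modular) :=
  [set mod_proj modular f | f in [set f : set_fun | f \in submodular]].

(* fset_set sends infinite sets to fset0, but this cone is polyhedral and so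
   has finitely many extreme rays. *)
Definition num_rays : nat :=
  #|` fset_set [set r | extreme_ray submodular_cone r] |.

End SubmodularCone.

(* Main.v *)
Require Import Defs.
From mathcomp Require Import boolp classical_sets cardinality reals.
From mathcomp Require Import all_boot all_order all_algebra all_fingroup.
From mathcomp Require Import ring lra.

(** A submodular function, taken modulo modular functions, spans an extreme ray
    as soon as it is rigid: the pairs of sets where its submodularity inequality
    is an equality determine it up to scaling and modular functions.  An extreme
    ray is in turn determined by these tight pairs, so there are finitely many
    of them, and t_n is at least the size of any family of pairwise independent
    non-modular rigid submodular functions ([num_rays_ge]).

    The doubly exponential growth comes from squaring such a family when one
    element is added to the ground set.  A function on n+1 elements is a pair
    (f, g): its values on the sets avoiding the new element, and on those
    containing it.  It is submodular iff f and g are and the increment of g in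
    each direction j is everywhere at most that of f.  Given two rays f and g,
    replace g by t g + m with t > 0 and m linear, as large as this condition
    allows; then in each direction the increments of f and t g + m touch at
    some set.  A function G that is tight wherever the pair is tight must be
    c f + linear below and d g + linear above by rigidity of f and g.  One
    contact in direction j equates the linear parts in direction j, and two
    contacts in one direction i with different increments of g force d = c t,
    so that the pair is rigid.  A suitable t exists as soon as no set both
    minimises the increment of f and maximises the increment of g in direction
    i ([two_minimisers], [glue_exists]).

    This last condition holds for all pairs from a family at once if a single
    collection U of sets contains every minimiser, and no maximiser, of the
    increments in direction i of the members of the family.  Glued functions
    are separated in the same way by the preimage of U, and their two halves
    recover (f, g) up to scaling.  Hence N separated rays on n elements give
    N^2 on n+1 elements ([gluable_rays_double]), and N^(2^m) on n+m.

    For n = 4 the eleven functions A |-> -[S subset of A] with |S| >= 2 are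
    enough.  For n >= 5 the family starts with six explicit rays on five
    elements, all of whose increments are separated, in every direction, by the
    sets with at least two elements.  Their stabilisers in S_5 are trivial and
    they lie in different orbits, so that their images form a family of
    720 >= 656 rays.  Since 11^2 <= 656, this also yields the first bound for
    n >= 5. *)

Set Implicit Arguments.
Unset Strict Implicit.
Unset Printing Implicit Defensive.

Import Order.TTheory GRing.Theory Num.Theory.

(** * Increments of set functions *)

Section Increments.
Local Open Scope ring_scope.
Variables (R : realType) (n : nat).
Implicit Types (f g : set_fun R n) (A B C E : {set 'I_n}) (i j : 'I_n).

(** Removing j from A on the right makes the increment a total function of A,
    so that its extrema may be taken over all sets. *)
Definition incr j (h : {set 'I_n} -> R) A : R := h (j |: A) - h (A :\ j).

Lemma incrE j h A : j \notin A -> h (j |: A) = h A + incr j h A.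
Proof.
move=> jA; rewrite /incr (_ : (A :\ j) = A); first by rewrite addrC subrK.
by apply/setDidPl; rewrite disjoint_sym disjoints1.
Qed.

Lemma incr_linear j a f g A : incr j (f - a *: g) A = incr j f A - a * incr j g A.
Proof. by rewrite /incr !ffunE /GRing.scale/=; ring. Qed.

Lemma set_chain_le (h : {set 'I_n} -> R) A B : A \subset B ->
  (forall E j, A \subset E -> E \subset B -> j \notin E -> j \in B ->
    h E <= h (j |: E)) ->
  h A <= h B.
Proof.
move=> sAB hS; have [k] := ubnP #|B :\: A|; elim: k A sAB hS => // k IHk A sAB hS.
have [BA0 _|/set0Pn[j]] := eqVneq (B :\: A) set0.
  suff -> : A = B by [].
  by apply/eqP; rewrite eqEsubset sAB -setD_eq0 BA0 eqxx.
rewrite inE => /andP[jA jB] cardBA.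
apply: le_trans (hS _ _ (subxx _) sAB jA jB) _; apply: IHk.
- by rewrite subUset sub1set jB.
- move=> E i; rewrite subUset => /andP[_ sAE]; exact: hS.
- rewrite ltnS in cardBA; apply: leq_trans cardBA; apply: proper_card.
  rewrite properE setDS ?subsetUr//=; apply/subsetPn; exists j.
    by rewrite inE jA.
  by rewrite !inE eqxx.
Qed.

Lemma set_chain_eq (h : {set 'I_n} -> R) A B : A \subset B ->
  (forall E j, A \subset E -> E \subset B -> j \notin E -> j \in B ->
    h (j |: E) = h E) ->
  h A = h B.
Proof.
move=> sAB hS; apply/eqP; rewrite eq_le set_chain_le//=; last first.
  by move=> E j AE EB jE jB; rewrite hS.
rewrite -lerN2; apply: (set_chain_le (h := fun E => - h E)) sAB _.
by move=> E j AE EB jE jB; rewrite hS.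
Qed.

Lemma submodular_incrP f : reflect
  (forall j A B, A \subset B -> incr j f B <= incr j f A) (f \in @submodular R n).
Proof.
apply: (iffP (submodularP f)) => [fP j A B sAB|fD A B].
  have := fP (j |: A) (B :\ j).
  suff [-> ->] : (j |: A) :|: (B :\ j) = j |: B /\ (j |: A) :&: (B :\ j) = A :\ j.
    by rewrite /incr => ?; lra.
  by split; apply/setP => x; rewrite !inE; case: eqP => //= _;
    case: (boolP (x \in A)) => // /(subsetP sAB) ->.
have /= := @set_chain_le (fun E => f E - f (A :|: E)) _ _ (subsetIr A B) _.
rewrite (setUidPl (subsetIl A B)) => chain; suff : f (A :&: B) - f A <= f B - f (A :|: B) by lra.
apply: chain => E j sE _ jE jB.
have jA : j \notin A.
  by apply: contra jE => jA; apply: (subsetP sE); rewrite inE jA.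
rewrite setUCA !incrE ?inE ?negb_or ?jA//.
by have := fD j _ _ (subsetUr A E); lra.
Qed.

Lemma modular_incrP f : reflect
  (forall j A, incr j f A = incr j f set0) (f \in @modular R n).
Proof.
have incrN j A : incr j (- f) A = - incr j f A by rewrite /incr !ffunE; ring.
rewrite modular_lineality; apply: (iffP andP).
  move=> [/submodular_incrP fD /submodular_incrP NfD] j A; apply/eqP.
  rewrite eq_le fD ?sub0set//=.
  by have := NfD j _ _ (sub0set A); rewrite !incrN lerN2.
move=> fD; split; apply/submodular_incrP => j A B _; last rewrite !incrN.
  by rewrite fD -(fD j A).
by rewrite fD -(fD j A).
Qed.

Lemma incr0_constant (h : {set 'I_n} -> R) :
  (forall j A, incr j h A = 0) -> forall A, h A = h set0.
Proof.
move=> h0 A; apply/esym/set_chain_eq; first exact: sub0set.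
by move=> E j _ _ jE _; rewrite incrE// h0 addr0.
Qed.

Lemma modular_eq0 f : f \in @modular R n -> f set0 = 0 ->
  (forall j, f [set j] = 0) -> forall A, f A = 0.
Proof.
move=> /modular_incrP fD f0 f1 A; rewrite (incr0_constant (h := f)) // => j B.
by rewrite fD /incr setU0 set0D f0 f1 subrr.
Qed.

Definition linear_fun (mu : 'I_n -> R) : set_fun R n :=
  [ffun A : {set 'I_n} => \sum_(j in A) mu j].

Lemma incr_linear_fun mu j A : incr j (linear_fun mu) A = mu j.
Proof.
rewrite /incr !ffunE (big_setD1 j) ?setU11//= (_ : (j |: A) :\ j = A :\ j) ?addrK//.
by apply/setP => k; rewrite !inE; case: eqP.
Qed.

Lemma linear_fun_modular mu : linear_fun mu \in @modular R n.
Proof. by apply/modular_incrP => j A; rewrite !incr_linear_fun. Qed.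

(** Values at the empty set and at singletons can be normalised to zero, which
    turns equality modulo modular functions into equality. *)
Lemma modular_part f : exists2 m, m \in @modular R n &
  (f - m) set0 = 0 /\ forall j, (f - m) [set j] = 0.
Proof.
pose mu j : R := f [set j] - f set0.
pose c : set_fun R n := [ffun _ : {set 'I_n} => f set0].
have cM : c \in @modular R n by apply/modularP => A B; rewrite !ffunE.
exists (c + linear_fun mu); first by rewrite rpredD// linear_fun_modular.
split=> [|j]; rewrite !ffunE; first by rewrite big_set0 addr0 subrr.
by rewrite big_set1 /mu; ring.
Qed.

End Increments.

(** * Rigid functions and extreme rays *)

Section Rays.
Local Open Scope ring_scope.
Variables (R : realType) (n : nat).
Implicit Types (f g : set_fun R n) (A B C E : {set 'I_n}) (i j : 'I_n).

Definition tight f A B : Prop := f (A :|: B) + f (A :&: B) = f A + f B.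

(** The tight pairs of f cut out the smallest face of the cone that contains f;
    rigidity says that f and the lineality space span this face. *)
Definition rigid f :=
  forall g, (forall A B, tight f A B -> tight g A B) ->
  exists c : R, g - c *: f \in @modular R n.

Definition spans_ray f :=
  [/\ f \in @submodular R n, f \notin @modular R n & rigid f].

Definition ray_of f : set (mod_quot (@modular R n)) :=
  [set a *: mod_proj (@modular R n) f | a in [set a : R | 0 <= a]]%classic.

Local Notation pr := (mod_proj (@modular R n)).
Local Notation cone := (@submodular_cone R n).

Lemma mod_projZ a f : a *: pr f = pr (a *: f).
Proof. exact: mod_quot_scaleE. Qed.

Lemma submodularZ (a : R) f : 0 <= a -> f \in @submodular R n -> a *: f \in @submodular R n.
Proof.
move=> a0 /submodularP fP; apply/submodularP => A B.
rewrite !ffunE -!scalerDr; exact: ler_wpM2l (fP A B).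
Qed.

Lemma mod_projB_eq f g : pr f = pr g -> f - g \in @modular R n.
Proof. by move=> e; rewrite -mod_projE e. Qed.

Lemma tight_modular f g A B : f - g \in @modular R n -> tight f A B -> tight g A B.
Proof. by move=> /modularP/(_ A B); rewrite !ffunE /tight => *; lra. Qed.

(** Two submodularity defects are nonnegative, so they vanish when their sum
    does: this is where a decomposition of a rigid function into submodular
    summands becomes a statement about tight pairs. *)
Lemma tight_sum f g h A B : f \in @submodular R n -> g \in @submodular R n ->
  f + g - h \in @modular R n -> tight h A B -> tight f A B.
Proof.
move=> /submodularP/(_ A B) fP /submodularP/(_ A B) gP /modularP/(_ A B).
by rewrite !ffunE /tight => *; lra.
Qed.

Lemma strict_pair f : f \in @submodular R n -> f \notin @modular R n ->
  exists A B, f (A :|: B) + f (A :&: B) < f A + f B.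
Proof.
move=> /submodularP fP /negP fM; apply/not_existsP => fS.
apply: fM; apply/modularP => A B; apply/eqP; rewrite eq_le fP leNgt.
by apply/negP => lt; case: (fS A); exists B.
Qed.

(** A summand of a multiple of f is tight wherever f is, hence of the form
    d f + modular; comparing defects at a pair where f is strict gives d >= 0. *)
Lemma ray_of_extreme f : spans_ray f -> extreme_ray cone (ray_of f).
Proof.
move=> [fS fM rf]; exists (pr f); first split.
- by exists f.
- apply: contraNneq fM => pf0.
  have : pr f = pr 0 by rewrite pf0; apply: (addIr (pr 0)); rewrite -mod_projD !add0r.
  by move/mod_projB_eq; rewrite subr0.
split=> //.
- by move=> _ [a a0 <-]; exists (a *: f); [exact: submodularZ | rewrite mod_projZ].
move=> _ _ [g gS <-] [h hS <-] [c c0]; rewrite -mod_projD mod_projZ => /esym/mod_projB_eq ghM.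
suff ray g' h' : g' \in @submodular R n -> h' \in @submodular R n ->
    g' + h' - c *: f \in @modular R n -> ray_of f (pr g').
  by split; [exact: ray ghM | apply: (ray h g) => //; rewrite [h + g]addrC].
move=> g'S h'S g'h'M.
have [|d /[dup] g'M /modularP g'E] := rf g'.
  move=> A B fAB; apply: tight_sum g'h'M _ => //.
  by move: fAB; rewrite /tight !ffunE -!scalerDr => ->.
have [A [B fAB]] := strict_pair fS fM.
exists d => /=; last by rewrite mod_projZ; apply/eqP; rewrite eq_sym mod_projE.
have /submodularP/(_ A B) := g'S; have := g'E A B; rewrite !ffunE /GRing.scale/=.
move=> e1 e2; rewrite leNgt; apply/negP => d0.
have : 0 < - d * (f A + f B - (f (A :|: B) + f (A :&: B))) :> R.
  by apply: mulr_gt0; [rewrite oppr_gt0 | move: fAB; lra].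
move: e1 e2; lra.
Qed.

Lemma dominated_multiple (T : finType) (p q : T -> R) :
  (forall x, 0 <= p x) -> (forall x, 0 <= q x) ->
  (forall x, p x = 0 -> q x = 0) -> exists2 e : R, 0 < e & forall x, e * q x <= p x.
Proof.
move=> p0 q0 pq.
pose m := \big[Order.min/1]_(x | 0 < q x) (p x / q x).
have m_gt0 : 0 < m.
  rewrite /m; elim/big_ind: _ => // [x y x0 y0|x qx]; first by rewrite lt_min x0.
  rewrite divr_gt0// lt_neqAle p0 andbT eq_sym; apply: contraTneq qx => /pq ->.
  by rewrite ltxx.
exists m => // x; have [qx|qx] := ltP 0 (q x).
  by rewrite -ler_pdivlMr//; apply: bigmin_le_cond.
have -> : q x = 0 by apply: le_anti; rewrite qx q0.
by rewrite mulr0.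
Qed.

(** Defined from the ray and not from a generator, so that no generator has to
    be chosen. *)
Definition tight_pairs (r : set (mod_quot (@modular R n))) :
    {set {set 'I_n} * {set 'I_n}} :=
  [set AB | `[< forall f, f \in @submodular R n -> r (pr f) -> tight f AB.1 AB.2 >]].

Lemma tight_pairsE r f : f \in @submodular R n ->
  r = [set a *: pr f | a in [set a : R | 0 <= a]]%classic ->
  forall A B, (A, B) \in tight_pairs r <-> tight f A B.
Proof.
move=> fS -> A B; rewrite inE; split=> [/asboolP/(_ f fS)|fAB].
  by apply; exists 1; rewrite ?scale1r//= ler01.
apply/asboolP => g gS [a a0]; rewrite mod_projZ => /mod_projB_eq afgM.
apply: tight_modular afgM _; move: fAB; rewrite /tight !ffunE -!scalerDr.
by move=> ->.
Qed.

(** If the generators f and g of two extreme rays have the same tight pairs then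
    f - e g is submodular for a small e > 0, so e g is a summand of f and lies
    on the ray of f.  Hence rays inject into the sets of pairs. *)
Lemma extreme_ray_finite : finite_set [set r | extreme_ray cone r]%classic.
Proof.
have sub r s : extreme_ray cone r -> extreme_ray cone s ->
    tight_pairs r = tight_pairs s -> (s `<=` r)%classic.
  move=> [x [[f fS <-] x0] [rE rC rX]] [y [[g gS <-] y0] [sE sC sX]] rs.
  have [||| e e0 fg] := @dominated_multiple _
    (fun AB : {set 'I_n} * {set 'I_n} =>
       f AB.1 + f AB.2 - (f (AB.1 :|: AB.2) + f (AB.1 :&: AB.2)))
    (fun AB => g AB.1 + g AB.2 - (g (AB.1 :|: AB.2) + g (AB.1 :&: AB.2))).
  - by move=> [A B] /=; rewrite subr_ge0; exact: (submodularP f fS).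
  - by move=> [A B] /=; rewrite subr_ge0; exact: (submodularP g gS).
  - move=> [A B] /= fAB; have /(tight_pairsE fS rE) : tight f A B.
      by rewrite /tight; lra.
    by rewrite rs => /(tight_pairsE gS sE); rewrite /tight; lra.
  have egS : e *: g \in @submodular R n by apply: submodularZ gS; exact: ltW.
  have fgS : f - e *: g \in @submodular R n.
    apply/submodularP => A B; have := fg (A, B); rewrite !ffunE /GRing.scale/=.
    lra.
  have [|||_ +] := rX (pr (f - e *: g)) (pr (e *: g)); [by exists (f - e *: g) | by exists (e *: g) | |].
    by rewrite -mod_projD subrK rE; exists 1; rewrite ?scale1r//= ler01.
  rewrite rE sE => -[a a0 aE] _ [b b0 <-].
  exists (b / e * a); first by rewrite /= !mulr_ge0// invr_ge0 ltW.
  rewrite -scalerA aE -mod_projZ scalerA divfK//; exact: lt0r_neq0.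
pose ray_with t := xget classical_sets.set0
  [set r | extreme_ray cone r /\ tight_pairs r = t]%classic.
apply: (@sub_finite_set _ _ (ray_with @` [set: _])%classic); last first.
  exact/finite_image/finite_finset.
move=> r rC; exists (tight_pairs r) => //; rewrite /ray_with.
case: xgetP => [s _ [sC sr]|/(_ r)[]//].
by apply/seteqP; split; apply: sub => //; rewrite sr.
Qed.

Lemma num_rays_ge (I : finType) (F : I -> set_fun R n) :
  (forall k, spans_ray (F k)) ->
  (forall k l (a : R), F k - a *: F l \in @modular R n -> k = l) ->
  (#|I| <= num_rays R n)%N.
Proof.
move=> Fray Finj; rewrite /num_rays cardE -(size_map (fun k => ray_of (F k))).
apply: uniq_leq_size; last first.
  move=> _ /mapP[k _ ->]; rewrite in_fset_set; last exact: extreme_ray_finite.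
  by apply/mem_set/ray_of_extreme.
rewrite map_inj_uniq ?enum_uniq// => k l kl.
have : ray_of (F k) (pr (F k)) by exists 1; rewrite ?scale1r//= ler01.
rewrite kl => -[a _]; rewrite mod_projZ => /esym/mod_projB_eq; exact: Finj.
Qed.

Lemma spans_ray_equiv f g (t : R) : 0 < t -> g - t *: f \in @modular R n ->
  spans_ray f -> spans_ray g.
Proof.
move=> t0 gfM [fS fM rf].
have gf A B : g (A :|: B) + g (A :&: B) - (g A + g B) =
    t * (f (A :|: B) + f (A :&: B) - (f A + f B)).
  by have /modularP/(_ A B) := gfM; rewrite !ffunE /GRing.scale/= => ?; lra.
have gft A B : tight g A B <-> tight f A B.
  rewrite /tight; split=> e; apply/eqP; rewrite -subr_eq0.
    rewrite -(mulrI_eq0 _ (mulfI (lt0r_neq0 t0))) -gf subr_eq0; exact/eqP.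
  by rewrite gf (_ : _ - _ = 0) ?mulr0// e subrr.
split.
- apply/submodularP => A B; rewrite -subr_le0 gf pmulr_rle0// subr_le0.
  exact: (submodularP f fS).
- apply: contra fM => /modularP gM; apply/modularP => A B.
  by apply/gft/gM.
move=> h hg; have [|c hcM] := rf h; first by move=> A B /gft; exact: hg.
exists (c / t); rewrite (_ : _ - _ = (h - c *: f) - (c / t) *: (g - t *: f)).
  by rewrite rpredB// rpredZ.
by rewrite scalerBr scalerA divfK ?lt0r_neq0// opprB addrA subrK.
Qed.

Lemma rigid_normalised f :
  (forall g, g set0 = 0 -> (forall j, g [set j] = 0) ->
     (forall A B, tight f A B -> tight g A B) ->
     exists c : R, forall A, g A = c * f A) ->
  rigid f.
Proof.
move=> fP g gt; have [m mM [g0 g1]] := modular_part g.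
have [||| c gc] := fP (g - m) => //.
  move=> A B /gt; apply: tight_modular.
  by rewrite opprB addrC subrK.
exists c; rewrite (_ : _ - _ = m) //; apply/ffunP => A.
by have := gc A; rewrite !ffunE /GRing.scale/= => <-; ring.
Qed.

Lemma proportional_of_modular f g (a : R) :
  f set0 = 0 -> g set0 = 0 -> (forall j, f [set j] = 0) -> (forall j, g [set j] = 0) ->
  f - a *: g \in @modular R n -> forall A, f A = a * g A.
Proof.
move=> f0 g0 f1 g1 /modular_eq0 fg A.
have : (f - a *: g) A = 0.
  by apply: fg => [|j]; rewrite !ffunE ?f0 ?g0 ?f1 ?g1 scaler0 subrr.
by rewrite !ffunE => /eqP; rewrite subr_eq0 => /eqP.
Qed.

(** Increments of submodular functions decrease, from their maximum at the empty
    set to their minimum at the full set: all minimisers lie in U and all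
    maximisers outside. *)
Definition separated i (U : pred {set 'I_n}) f :=
  forall A, if U A then incr i f A < incr i f set0 else incr i f setT < incr i f A.

End Rays.

(** * The rays of principal filters *)

Section Filters.
Local Open Scope ring_scope.
Variables (R : realType) (n : nat).
Implicit Types (S T A B : {set 'I_n}) (f g : set_fun R n).

Definition filter_fun S : set_fun R n :=
  [ffun A : {set 'I_n} => if S \subset A then -1 else 0].

Lemma filter_fun_submodular S : filter_fun S \in @submodular R n.
Proof.
apply/submodularP => A B; rewrite !ffunE subsetI.
case: (boolP (S \subset A)) => [SA|_]; case: (boolP (S \subset B)) => [SB|_];
  rewrite /= ?(subset_trans SA (subsetUl _ _)) ?(subset_trans SB (subsetUr _ _)) ?lexx//; try lra.
by case: ifP; lra.
Qed.

Lemma filter_fun0 S A : ~~ (S \subset A) -> filter_fun S A = 0.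
Proof. by rewrite ffunE => /negbTE ->. Qed.

Lemma filter_fun1 S A : S \subset A -> filter_fun S A = -1.
Proof. by rewrite ffunE => ->. Qed.

Lemma large_not_sub_set0 S : (1 < #|S|)%N -> ~~ (S \subset set0).
Proof. by apply: contraL => /subset_leq_card; rewrite cards0; case: #|S|. Qed.

Lemma large_not_sub_set1 S j : (1 < #|S|)%N -> ~~ (S \subset [set j]).
Proof. by apply: contraL => /subset_leq_card; rewrite cards1 ltnNge => ->. Qed.

(** All pairs (A, {j}) with j not in A are tight unless adding j to A completes
    S, so a normalised g which is tight there is unchanged by adding elements,
    except at the step where the set comes to contain S. *)
Lemma filter_fun_spans_ray S : (1 < #|S|)%N -> spans_ray (filter_fun S).
Proof.
move=> S1; have S0 := large_not_sub_set0 S1; have Sj j := large_not_sub_set1 j S1.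
split; first exact: filter_fun_submodular.
  apply/negP => /modular_eq0 /(_ (filter_fun0 S0) (fun j => filter_fun0 (Sj j)) S).
  by rewrite filter_fun1// => /eqP; rewrite oppr_eq0 oner_eq0.
apply: rigid_normalised => g g0 g1 gt.
have step A j : j \notin A -> ((S \subset j |: A) = (S \subset A)) -> g (j |: A) = g A.
  move=> jA SA.
  have jA0 : A :&: [set j] = set0 by apply/eqP; rewrite setIC setI_eq0 disjoints1.
  have : tight g A [set j].
    apply: gt; rewrite /tight jA0 (filter_fun0 S0) (filter_fun0 (Sj j)) setUC.
    by rewrite !ffunE SA.
  by rewrite /tight jA0 g0 g1 !addr0 setUC.
exists (- g S) => A; case: (boolP (S \subset A)) => SA.
  rewrite filter_fun1// mulrN1 opprK; apply/esym/set_chain_eq => // E j SE _ jE _.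
  by apply: step => //; rewrite SE (subset_trans SE (subsetUr _ _)).
rewrite filter_fun0// mulr0 -g0; apply/esym/set_chain_eq; first exact: sub0set.
move=> E j _ EA jE jA; apply: step => //.
have SE B : B \subset A -> (S \subset B) = false.
  by move=> BA; apply/negbTE; apply: contra SA => /subset_trans; apply.
by rewrite !SE// subUset sub1set jA.
Qed.

Lemma filter_fun_injective S T (a : R) : (1 < #|S|)%N -> (1 < #|T|)%N ->
  filter_fun S - a *: filter_fun T \in @modular R n -> S = T.
Proof.
move=> S1 T1 STM.
have ST : forall A, filter_fun S A = a * filter_fun T A.
  apply: proportional_of_modular STM => *; apply: filter_fun0;
    by [exact: large_not_sub_set0 | exact: large_not_sub_set1].
have sTS : T \subset S.
  apply: contraT => /filter_fun0 TS; have /eqP := ST S.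
  by rewrite TS filter_fun1// mulr0 oppr_eq0 oner_eq0.
have a1 : a = 1.
  by have /eqP := ST S; rewrite !filter_fun1// mulrN1 eqr_opp eq_sym => /eqP.
apply/eqP; rewrite eqEsubset sTS andbT; apply: contraT => /filter_fun0 nST.
by have /eqP := ST T; rewrite nST filter_fun1// a1 mul1r eq_sym oppr_eq0 oner_eq0.
Qed.

(** The other sets are the empty set and the n singletons. *)
Lemma card_large_sets : (2 ^ n - n.+1 <= #|{: {S : {set 'I_n} | 1 < #|S|}}|)%N.
Proof.
rewrite card_sig leq_subLR -[n in (2 ^ n)%N]card_ord -cardsT -card_powerset powersetT cardsT.
rewrite -(cardC [pred S : {set 'I_n} | 1 < #|S|]%N) addnC leq_add2r.
have -> : n.+1 = #|set0 |: [set [set j] | j : 'I_n]|.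
  rewrite cardsU1 card_imset ?card_ord; last exact: set1_inj.
  by rewrite (_ : _ \notin _)//; apply/imsetP => -[j _ /setP/(_ j)]; rewrite !inE eqxx.
apply/subset_leq_card/subsetP => S; rewrite !inE -leqNgt leq_eqVlt ltnS leqn0 cards_eq0.
by case/orP => [/cards1P[j ->]|->]//; rewrite imset_f ?orbT.
Qed.

Lemma num_rays_filters : (2 ^ n - n.+1 <= num_rays R n)%N.
Proof.
apply: leq_trans card_large_sets _.
apply: (num_rays_ge (F := fun S : {S : {set 'I_n} | (1 < #|S|)%N} => filter_fun (val S))).
  by case=> S S1; exact: filter_fun_spans_ray.
by move=> [S S1] [T T1] a /= /filter_fun_injective ST; apply/val_inj/ST.
Qed.

End Filters.

(** * Gluing two rays along a new element *)

Section Glue.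
Local Open Scope ring_scope.
Variables (R : realType) (n : nat).
Implicit Types (f g : set_fun R n) (A B : {set 'I_n}) (S : {set 'I_n.+1}).
Implicit Types (i j : 'I_n) (h : set_fun R n.+1).

(** The new element is [ord0]; the old ones are embedded by [lift ord0]. *)
Definition trace S : {set 'I_n} := [set i | lift ord0 i \in S].
Definition embed A : {set 'I_n.+1} := [set lift ord0 i | i in A].

Lemma mem_embed i A : (lift ord0 i \in embed A) = (i \in A).
Proof. by rewrite mem_imset//; exact: lift_inj. Qed.

Lemma ord0_embed A : (ord0 \in embed A) = false.
Proof. by apply/imsetP => -[i _ /eqP]; rewrite (negbTE (neq_lift _ _)). Qed.

Lemma embedK : cancel embed trace.
Proof. by move=> A; apply/setP => i; rewrite inE mem_embed. Qed.

Lemma trace_setU S T : trace (S :|: T) = trace S :|: trace T.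
Proof. by apply/setP => i; rewrite !inE. Qed.

Lemma trace_setI S T : trace (S :&: T) = trace S :&: trace T.
Proof. by apply/setP => i; rewrite !inE. Qed.

Lemma trace_ord0 : trace [set ord0] = set0.
Proof. by apply/setP => i; rewrite !inE eq_sym (negbTE (neq_lift _ _)). Qed.

Lemma trace_add0 S : trace (ord0 |: S) = trace S.
Proof. by apply/setP => i; rewrite !inE eq_sym (negbTE (neq_lift _ _)). Qed.

Lemma trace_del0 S : trace (S :\ ord0) = trace S.
Proof. by apply/setP => i; rewrite !inE eq_sym (negbTE (neq_lift _ _)). Qed.

Lemma trace_add j S : trace (lift ord0 j |: S) = j |: trace S.
Proof. by apply/setP => i; rewrite !inE (inj_eq (@lift_inj _ _)). Qed.

Lemma trace_del j S : trace (S :\ lift ord0 j) = trace S :\ j.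
Proof. by apply/setP => i; rewrite !inE (inj_eq (@lift_inj _ _)). Qed.

Definition glue f g : set_fun R n.+1 :=
  [ffun S : {set 'I_n.+1} => if ord0 \in S then g (trace S) else f (trace S)].

Definition lower h : set_fun R n := [ffun A : {set 'I_n} => h (embed A)].
Definition upper h : set_fun R n := [ffun A : {set 'I_n} => h (ord0 |: embed A)].

Lemma lower_glue f g : lower (glue f g) = f.
Proof. by apply/ffunP => A; rewrite !ffunE ord0_embed embedK. Qed.

Lemma upper_glue f g : upper (glue f g) = g.
Proof. by apply/ffunP => A; rewrite !ffunE setU11 trace_add0 embedK. Qed.

Lemma glueK h : glue (lower h) (upper h) = h.
Proof.
apply/ffunP => S; rewrite !ffunE; case: ifP => S0; congr (h _);
  apply/setP => x; rewrite ?inE; case: (unliftP ord0 x) => [i|] ->;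
  by rewrite ?mem_embed ?ord0_embed ?inE ?eqxx//= eq_sym (negbTE (neq_lift _ _)).
Qed.

Lemma incr_glue f g j S : incr (lift ord0 j) (glue f g) S =
  if ord0 \in S then incr j g (trace S) else incr j f (trace S).
Proof.
rewrite /incr !ffunE !inE trace_add trace_del (negbTE (neq_lift _ _))/=.
by case: ifP.
Qed.

Lemma incr0_glue f g S : incr ord0 (glue f g) S = g (trace S) - f (trace S).
Proof. by rewrite /incr !ffunE !inE eqxx trace_add0 trace_del0. Qed.

Lemma lower_linear a h k : lower (h - a *: k) = lower h - a *: lower k.
Proof. by apply/ffunP => A; rewrite !ffunE. Qed.

Lemma upper_linear a h k : upper (h - a *: k) = upper h - a *: upper k.
Proof. by apply/ffunP => A; rewrite !ffunE. Qed.

Lemma lower_modular h : h \in @modular R n.+1 -> lower h \in @modular R n.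
Proof.
move=> hM; apply/modular_incrP => j A.
have /modular_incrP hD := hM.
have hDj S : ord0 \notin S -> incr (lift ord0 j) h S = incr j (lower h) (trace S).
  by move=> S0; rewrite -{1}[h]glueK incr_glue (negbTE S0).
rewrite -{1}[A]embedK -[in RHS](embedK set0) -!hDj ?ord0_embed//.
by rewrite !(hD _ (embed _)).
Qed.

Lemma upper_modular h : h \in @modular R n.+1 -> upper h \in @modular R n.
Proof.
move=> hM; apply/modular_incrP => j A.
have /modular_incrP hD := hM.
have hDj S : ord0 \in S -> incr (lift ord0 j) h S = incr j (upper h) (trace S).
  by move=> S0; rewrite -{1}[h]glueK incr_glue S0.
have tr B : trace (ord0 |: embed B) = B by rewrite trace_add0 embedK.
rewrite -{1}[A]tr -[in RHS](tr set0) -!hDj ?setU11//.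
by rewrite !(hD _ (_ |: _)).
Qed.

(** In the new direction the increment is g - f, which decreases because the
    increments of g are at most those of f. *)
Lemma glue_submodular f g :
  f \in @submodular R n -> g \in @submodular R n ->
  (forall j A, incr j g A <= incr j f A) -> glue f g \in @submodular R n.+1.
Proof.
move=> /submodular_incrP fS /submodular_incrP gS gf.
apply/submodular_incrP => x S T sST.
have sAB : trace S \subset trace T.
  by apply/subsetP => i; rewrite !inE; apply: (subsetP sST).
case: (unliftP ord0 x) => [j|] ->.
  rewrite !incr_glue; case: (boolP (ord0 \in S)) => [/(subsetP sST) ->|_].
    exact: gS.
  by case: ifP => _; [exact: le_trans (gS _ _ _ sAB) (gf _ _) | exact: fS].
rewrite !incr0_glue -lerN2 !opprB.
apply: (set_chain_le (h := fun A => f A - g A)) sAB _ => E j _ _ jE _.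
by rewrite !incrE//; have := gf j E; lra.
Qed.

Lemma glue_tight_below f g A B : tight f A B -> tight (glue f g) (embed A) (embed B).
Proof.
by rewrite /tight !ffunE !inE !ord0_embed !trace_setU !trace_setI !embedK.
Qed.

Lemma glue_tight_above f g A B : tight g A B ->
  tight (glue f g) (ord0 |: embed A) (ord0 |: embed B).
Proof.
rewrite /tight !ffunE !inE !eqxx/=.
by rewrite !(trace_setU, trace_setI, trace_ord0, set0U, embedK).
Qed.

(** This pair of sets differs exactly by j on one side and the new element on the
    other; its inequality compares the increments of g and f in direction j. *)
Lemma glue_tight_across f g j A : incr j g A = incr j f A <->
  tight (glue f g) (ord0 |: embed (A :\ j)) (embed (j |: A)).
Proof.
have e1 : (A :\ j) :|: (j |: A) = j |: A.
  by apply/setP => x; rewrite !inE; case: eqP => //= _; rewrite orbb.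
have e2 : (A :\ j) :&: (j |: A) = A :\ j.
  by apply/setP => x; rewrite !inE; case: eqP => //= _; rewrite andbb.
rewrite /tight /incr !ffunE !in_setU1 !in_setU !in_setI !in_set1 !eqxx !ord0_embed/=.
rewrite !(trace_setU, trace_setI, trace_ord0, set0U) !embedK e1 e2.
by rewrite andbF; split=> ?; lra.
Qed.

Lemma lower_tight h A B : tight h (embed A) (embed B) -> tight (lower h) A B.
Proof. by rewrite -{1}[h]glueK /tight !ffunE !inE !ord0_embed !trace_setU !trace_setI !embedK. Qed.

Lemma upper_tight h A B : tight h (ord0 |: embed A) (ord0 |: embed B) ->
  tight (upper h) A B.
Proof.
rewrite -{1}[h]glueK /tight; rewrite {1 2 3 4}/glue !ffunE !inE !eqxx/=.
by rewrite !(trace_setU, trace_setI, trace_ord0, set0U, embedK).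
Qed.

(** One contact in each direction ties the linear parts of the two halves
    together; the second contact in direction i, at a different increment of g,
    ties their scaling factors. *)
Lemma spans_ray_glue f g i A1 A2 :
  spans_ray f -> spans_ray g ->
  (forall j A, incr j g A <= incr j f A) ->
  (forall j, exists A, incr j g A = incr j f A) ->
  incr i g A1 = incr i f A1 -> incr i g A2 = incr i f A2 ->
  incr i g A1 != incr i g A2 ->
  spans_ray (glue f g).
Proof.
move=> [fS fM rf] [gS gM rg] gf touch touch1 touch2 neq12; split.
- exact: glue_submodular.
- by apply: contra fM => /lower_modular; rewrite lower_glue.
move=> h htight.
have [c lowM] : exists c : R, lower h - c *: f \in @modular R n.
  by apply: rf => A B fAB; apply/lower_tight/htight/glue_tight_below.
have [d upM] : exists d : R, upper h - d *: g \in @modular R n.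
  by apply: rg => A B gAB; apply/upper_tight/htight/glue_tight_above.
have hE j A : incr j g A = incr j f A -> incr j (upper h) A = incr j (lower h) A.
  by move=> gfA; apply/glue_tight_across; rewrite glueK; apply/htight/glue_tight_across.
have lowE j A := modular_incrP _ lowM j A.
have upE j A := modular_incrP _ upM j A.
have cross j A : incr j g A = incr j f A ->
    d * incr j g A + incr j (upper h - d *: g) set0 =
    c * incr j g A + incr j (lower h - c *: f) set0.
  move=> gfA; rewrite -(lowE j A) -(upE j A) !incr_linear hE// gfA; ring.
have dc : d = c.
  have := cross i A1 touch1; have := cross i A2 touch2 => e2 e1.
  apply/eqP; rewrite -subr_eq0; have := neq12; rewrite -subr_eq0 => /mulIf.
  move=> inj; apply/eqP/inj; rewrite mul0r; move: e1 e2; lra.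
rewrite {}dc in upM upE cross.
have slope j : incr j (upper h - c *: g) set0 = incr j (lower h - c *: f) set0.
  by have [A /cross] := touch j; apply: addrI.
(* k has equal constant increments on both halves in the old directions, so
   that k above minus k below, its increment in the new direction, is constant. *)
exists c; set k := _ - _.
have kE : k = glue (lower h - c *: f) (upper h - c *: g).
  by rewrite -[k]glueK lower_linear upper_linear lower_glue upper_glue.
apply/modular_incrP => x S; rewrite {k}kE.
case: (unliftP ord0 x) => [j|] ->.
  by rewrite !incr_glue inE lowE upE slope if_same [RHS]lowE.
rewrite !incr0_glue.
set p := upper h - _ in upM upE slope *; set q := lower h - _ in lowM lowE slope *.
rewrite -[RHS]/(p _ - q _); apply/eqP; rewrite eq_sym; apply/eqP.
pose D A := p A - q A.
have D0 j A : incr j D A = 0.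
  have : incr j D A = incr j p A - incr j q A by rewrite /incr /D; ring.
  by rewrite lowE upE slope subrr.
by rewrite -[RHS]/(D _) -[LHS]/(D _) (incr0_constant D0) [RHS](incr0_constant D0).
Qed.

(** In the plane of the points (q, p), the two minimisers span an edge of the
    lower convex hull with positive slope t.  It starts at the point x with p
    minimal and, among these, q maximal; as x does not maximise q, some points
    lie strictly to its right, and t is the smallest slope from x to one of
    them. *)
Lemma two_minimisers (T : finType) (p q : T -> R) (a b : T) :
  (forall x, p b <= p x) -> (forall x, q x <= q a) ->
  (forall x, p x = p b -> q x < q a) ->
  exists t : R, 0 < t /\ exists x y, q x != q y /\
    forall z, p x - t * q x <= p z - t * q z /\ p y - t * q y <= p z - t * q z.
Proof.
move=> pb qa pq.
have [x /eqP px xmax] := @arg_maxP _ _ _ b (fun x => p x == p b) q (eqxx _).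
have xa : q x < q a by exact: pq.
pose slope z := (p z - p x) / (q z - q x).
have [y xy ymin] := @arg_minP _ _ _ a (fun z => q x < q z) slope xa.
have pxy : p x < p y.
  rewrite lt_neqAle px pb andbT eq_sym; apply: contraTN xy => /xmax.
  by rewrite -leNgt.
have t0 : 0 < slope y by rewrite divr_gt0 ?subr_gt0.
exists (slope y); split=> //; exists x, y; split; first by rewrite lt_eqF.
have ye : p y - slope y * q y = p x - slope y * q x.
  have : slope y * (q y - q x) = p y - p x by rewrite divfK// subr_eq0 gt_eqF.
  lra.
have xmin z : p x - slope y * q x <= p z - slope y * q z.
  have [xz|zx] := ltP (q x) (q z).
    have := ymin z xz; rewrite {2}/slope ler_pdivlMr ?subr_gt0//; lra.
  have := mulr_ge0 (ltW t0) (_ : 0 <= q x - q z); rewrite subr_ge0 => /(_ zx).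
  by have := pb z; rewrite -px; lra.
by move=> z; rewrite ye.
Qed.

(** The increment of the glued function at the empty set is that of f, and at the
    full set that of g.  These bound the corresponding extrema of the other
    half, because the increments of g are at most those of f. *)
Lemma separated_glue f g i U :
  (forall A, incr i g A <= incr i f A) ->
  separated i U f -> separated i U g ->
  separated (lift ord0 i) (fun S => U (trace S)) (glue f g).
Proof.
move=> gf sf sg S; rewrite !incr_glue !in_set0 in_setT.
have [-> ->] : trace set0 = set0 /\ trace setT = setT.
  by split; apply/setP => k; rewrite !inE.
have := sf (trace S); have := sg (trace S); case: ifP => _; case: ifP => _ // gS fS.
  exact: lt_le_trans gS (gf _).
exact: le_lt_trans (gf _) fS.
Qed.

(** The linear function added to t g has in direction j the largest slope mu j
    which keeps the increments below those of f, so that a minimiser of the gap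
    is a contact; t is chosen to give two such minimisers in direction i. *)
Lemma glue_exists f g i U : spans_ray f -> spans_ray g ->
  separated i U f -> separated i U g ->
  exists h, [/\ spans_ray h,
    separated (lift ord0 i) (fun S => U (trace S)) h,
    lower h = f &
    exists2 t : R, 0 < t & upper h - t *: g \in @modular R n].
Proof.
move=> fR gR sf sg.
have [/submodular_incrP fS _ _] := fR; have [/submodular_incrP gS _ _] := gR.
have [||| t [t0 [x [y [xy xyP]]]]] := @two_minimisers _ (incr i f) (incr i g) set0 setT.
- by move=> A; apply/fS/subsetT.
- by move=> A; apply/gS/sub0set.
- move=> A fA; have := sf A; have := sg A; case: ifP => // _ _.
  by rewrite fA ltxx.
pose gap j A : R := incr j f A - t * incr j g A.
pose mu j : R := gap j [arg min_(A < set0) gap j A]%O.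
have mu_le j A : mu j <= gap j A by rewrite /mu; case: arg_minP => // B _; exact.
pose g' : set_fun R n := t *: g + linear_fun mu.
have g'E j A : incr j g' A = t * incr j g A + mu j.
  by rewrite -(incr_linear_fun mu j A) /incr !ffunE /GRing.scale/=; ring.
have g'M : g' - t *: g \in @modular R n.
  by rewrite addrAC subrr add0r linear_fun_modular.
have g'f j A : incr j g' A <= incr j f A.
  by rewrite g'E; have := mu_le j A; rewrite /gap; lra.
have muE A : (forall B, gap i A <= gap i B) -> mu i = gap i A.
  by move=> Amin; apply: le_anti; rewrite mu_le /mu Amin.
have mux : mu i = gap i x by apply: muE => B; case: (xyP B).
have muy : mu i = gap i y by apply: muE => B; case: (xyP B).
exists (glue f g'); split.
- apply: (@spans_ray_glue _ _ i x y) => //.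
  + exact: spans_ray_equiv t0 g'M gR.
  + move=> j; have [A muA] : exists A, mu j = gap j A by exists [arg min_(A < set0) gap j A]%O.
    by exists A; rewrite g'E muA /gap addrC subrK.
  + by rewrite g'E mux /gap addrC subrK.
  + by rewrite g'E muy /gap addrC subrK.
  + rewrite !g'E (inj_eq (addIr _)); apply: contra_neq xy.
    exact: (mulfI (lt0r_neq0 t0)).
- apply: separated_glue sf _ => // A.
  by have := sg A; rewrite !g'E; case: ifP => _; rewrite ltrD2r ltr_pM2l.
- exact: lower_glue.
- by exists t => //; rewrite upper_glue.
Qed.

End Glue.

(** * Squaring a separated family *)

Section Doubling.
Local Open Scope ring_scope.
Variable R : realType.

(** The last condition amounts to distinctness of the rays: a negative factor a
    cannot occur between submodular functions that are not modular. *)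
Definition gluable_rays n N := exists (i : 'I_n) (U : pred {set 'I_n})
    (I : finType) (F : I -> set_fun R n),
  [/\ (N <= #|I|)%N,
      forall k, spans_ray (F k),
      forall k, separated i U (F k) &
      forall k l (a : R), F k - a *: F l \in @modular R n -> k = l].

Lemma gluable_rays_double n N : gluable_rays n N -> gluable_rays n.+1 (N ^ 2).
Proof.
move=> [i [U [I [F [NI Fray Fsep Finj]]]]].
have /choice[G GP] : forall kl : I * I, exists h, _ :=
  fun kl => glue_exists (Fray kl.1) (Fray kl.2) (Fsep kl.1) (Fsep kl.2).
exists (lift ord0 i), (fun S => U (trace S)), (I * I)%type, G; split.
- by rewrite card_prod leq_mul.
- by move=> kl; case: (GP kl).
- by move=> kl; case: (GP kl).
move=> [k l] [k' l'] a GM.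
have [_ _ lowk [t t0 upk]] := GP (k, l); have [_ _ lowk' [t' t'0 upk']] := GP (k', l').
congr pair.
  by apply: (Finj _ _ a); have := lower_modular GM; rewrite lower_linear lowk lowk'.
(* Above, the glued functions are t (F l) and t' (F l') modulo modular ones. *)
apply: (Finj _ _ (t^-1 * a * t')).
have := upper_modular GM; rewrite upper_linear => upM.
move: upk upk'; set p := upper _ in upM *; set p' := upper _ in upM *; move=> upk upk'.
rewrite (_ : _ - _ = t^-1 *: ((p - a *: p') - (p - t *: F l) + a *: (p' - t' *: F l'))).
  by apply/rpredZ/rpredD; [exact: rpredB | exact: rpredZ].
by apply/ffunP => A; rewrite !ffunE /GRing.scale/=; field; exact: lt0r_neq0.
Qed.

Lemma gluable_rays_iter n N m : gluable_rays n N -> gluable_rays (m + n) (N ^ (2 ^ m)).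
Proof.
move=> nN; elim: m => [|m IHm]; first by rewrite expn1.
by rewrite addSn expnSr expnM; apply: gluable_rays_double.
Qed.

Lemma gluable_rays_num n N : gluable_rays n N -> (N <= num_rays R n)%N.
Proof.
move=> [i [U [I [F [NI Fray _ Finj]]]]]; apply: leq_trans NI _.
exact: num_rays_ge Fray Finj.
Qed.

End Doubling.

(** * Integer systems with only the zero solution *)

Section Elimination.
Local Open Scope ring_scope.

(** Fraction-free: the head of r is cancelled against that of the pivot p. *)
Definition eliminate (p r : seq int) : seq int :=
  if head 0 r == 0 then behead r
  else [seq head 0 p * ab.1 - head 0 r * ab.2 | ab <- zip (behead r) (behead p)].

(** Gaussian elimination, one column at a time.  The pivot row stays in the list
    and eliminates itself into a row of zeros. *)
Fixpoint only_zero_solution (m : nat) (rows : seq (seq int)) : bool :=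
  if m is m'.+1 then
    if [seq r <- rows | head 0 r != 0] is p :: _
    then only_zero_solution m' [seq eliminate p r | r <- rows] else false
  else true.

Variable R : numDomainType.
Implicit Types (r p : seq int) (x : seq R).

Definition dot r x : R := \sum_(ab <- zip r x) ab.1%:~R * ab.2.

Lemma dot_cons a r b x : dot (a :: r) (b :: x) = a%:~R * b + dot r x.
Proof. by rewrite /dot /= big_cons. Qed.

Lemma dot_combine (a b : int) r p x : size r = size p ->
  dot [seq a * cd.1 - b * cd.2 | cd <- zip r p] x = a%:~R * dot r x - b%:~R * dot p x.
Proof.
elim: r p x => [|c r IHr] [|d p] [|y x] //=;
  try by rewrite /dot ?zip0s ?zips0 !big_nil !mulr0 subr0.
by move=> [sz]; rewrite !dot_cons IHr// rmorphB !rmorphM/=; ring.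
Qed.

Lemma dot0 r x : (forall y, y \in x -> y = 0) -> dot r x = 0.
Proof.
elim: r x => [|a r IHr] [|b x] x0; rewrite ?dot_cons /dot ?zip0s ?zips0 ?big_nil//.
rewrite -/(dot r x) (x0 b) ?mem_head// mulr0 add0r IHr// => y yx.
by apply: x0; rewrite inE yx orbT.
Qed.

Lemma only_zero_solutionP m rows x : only_zero_solution m rows ->
  size x = m -> all (fun r => size r == m) rows ->
  {in rows, forall r, dot r x = 0} -> forall y, y \in x -> y = 0.
Proof.
elim: m rows x => [|m IHm] rows [|x0 x]//=.
case E: (filter _ rows) => [|p ps]// ker [szx] /allP szr rx.
have /[!mem_filter]/andP[p0 pr] : p \in [seq r <- rows | head 0 r != 0].
  by rewrite E mem_head.
case: p p0 pr ker {E ps} => [|p0 p]; first by rewrite eqxx.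
rewrite [head _ _]/= => p0N pr ker.
have sp : size p = m by have /eqP[] := szr _ pr.
have px := rx _ pr; rewrite dot_cons in px.
have x0' : forall y, y \in x -> y = 0.
  apply: IHm ker szx _ _.
    apply/allP => _ /mapP[[|r0 r] rr ->]; have := szr _ rr => //= /eqP[sr].
    by rewrite /eliminate/=; case: ifP => _; rewrite ?size_map ?size_zip ?sr ?sp ?minnn.
  move=> _ /mapP[[|r0 r] rr ->]; have := szr _ rr => //= /eqP[sr].
  have := rx _ rr; rewrite dot_cons /eliminate/=; case: eqP => [->|_].
    by rewrite mul0r add0r.
  move=> rx0; rewrite dot_combine ?sr ?sp//.
  have -> : dot r x = - (r0%:~R * x0) by apply/eqP; rewrite -addr_eq0 addrC rx0.
  have -> : dot p x = - (p0%:~R * x0) by apply/eqP; rewrite -addr_eq0 addrC px.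
  ring.
move=> y; rewrite inE => /orP[/eqP ->|]; last exact: x0'.
by move/eqP: px; rewrite (dot0 _ x0') addr0 mulf_eq0 intr_eq0 (negbTE p0N) => /eqP.
Qed.

End Elimination.

(** * Subsets as bit vectors *)

Section Cube.
Variable n : nat.
Implicit Types (A B : {set 'I_n}) (u v b c : bitseq).

Fixpoint cube m : seq bitseq :=
  if m is m'.+1
  then [seq true :: b | b <- cube m'] ++ [seq false :: b | b <- cube m'] else [:: [::]].

Definition bits A : bitseq := [seq i \in A | i <- enum 'I_n].
Definition unbits b : {set 'I_n} := [set i : 'I_n | nth false b i].

Definition bor u v := [seq p.1 || p.2 | p <- zip u v].
Definition band u v := [seq p.1 && p.2 | p <- zip u v].
Definition bdiff u v := [seq p.1 && ~~ p.2 | p <- zip u v].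

Lemma bitsU A B : bits (A :|: B) = bor (bits A) (bits B).
Proof. by rewrite /bor zip_map -map_comp; apply: eq_map => i; rewrite /= inE. Qed.

Lemma bitsI A B : bits (A :&: B) = band (bits A) (bits B).
Proof. by rewrite /band zip_map -map_comp; apply: eq_map => i; rewrite /= inE. Qed.

Lemma bitsD A B : bits (A :\: B) = bdiff (bits A) (bits B).
Proof. by rewrite /bdiff zip_map -map_comp; apply: eq_map => i; rewrite /= inE andbC. Qed.

Lemma bitsT : bits setT = nseq n true.
Proof.
rewrite /bits (@eq_map _ _ _ (fun=> true)) => [|i]; last by rewrite inE.
by rewrite -[in RHS](size_enum_ord n); elim: (enum 'I_n) => //= i s ->.
Qed.

Lemma count_bits A : count id (bits A) = #|A|.
Proof. by rewrite /bits enumT count_map -size_filter cardE /enum_mem. Qed.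

Lemma bitsK : cancel bits unbits.
Proof.
move=> A; apply/setP => i; rewrite inE (nth_map i) ?size_enum_ord//.
by rewrite nth_ord_enum.
Qed.

Lemma mem_cube m b : (b \in cube m) = (size b == m).
Proof.
elim: m b => [|m IHm] [|x b] //=; rewrite mem_cat.
  by apply/negbTE; rewrite negb_or; apply/andP; split; apply/mapP => -[].
rewrite eqSS -IHm; apply/orP/idP => [[]/mapP[c cm [_ ->]]//|bm].
by case: x; [left | right]; apply: map_f.
Qed.

Lemma cube_uniq m : uniq (cube m).
Proof.
elim: m => //= m IHm; rewrite cat_uniq !map_inj_uniq ?IHm; try by move=> ? ? [].
by rewrite andbT; apply/hasPn => _ /mapP[c _ ->]; apply/mapP => -[].
Qed.

Lemma bits_cube A : bits A \in cube n.
Proof. by rewrite mem_cube size_map size_enum_ord. Qed.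

Lemma unbitsK b : b \in cube n -> bits (unbits b) = b.
Proof.
rewrite mem_cube => /eqP bn; rewrite /bits.
rewrite (@eq_map _ _ _ (fun i : 'I_n => nth false b i)) => [|i]; last by rewrite inE.
by rewrite (map_comp (nth false b) val) val_enum_ord -bn map_nth_iota0// take_size.
Qed.

Lemma all_cubeP (P : pred bitseq) : all P (cube n) -> forall A, P (bits A).
Proof. by move=> /allP Pc A; apply/Pc/bits_cube. Qed.

Lemma nth_bits A (i : 'I_n) : nth false (bits A) i = (i \in A).
Proof. by rewrite -{2}(bitsK A) inE. Qed.

Lemma sum_cube (F : bitseq -> nat) :
  sumn [seq F b | b <- cube n] = \sum_(A : {set 'I_n}) F (bits A).
Proof.
rewrite sumnE big_map -(big_map bits xpredT) -[index_enum _]enumT; apply: perm_big.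
apply: uniq_perm; first exact: cube_uniq.
  by rewrite map_inj_uniq ?enum_uniq//; exact: can_inj bitsK.
move=> b; apply/idP/mapP => [bn|[A _ ->]]; last exact: bits_cube.
by exists (unbits b); rewrite ?mem_enum ?unbitsK.
Qed.

End Cube.

(** * Permutations of the ground set *)

Section Pull.
Local Open Scope ring_scope.
Variables (R : realType) (n : nat).
Implicit Types (f g : set_fun R n) (A B : {set 'I_n}) (s t : 'S_n) (i : 'I_n).

Definition pull s f : set_fun R n := [ffun A : {set 'I_n} => f (s @^-1: A)].

Lemma preimset_permK s A : s @^-1: (s^-1%g @^-1: A) = A.
Proof. by apply/setP => i; rewrite !inE permK. Qed.

Lemma preimset_permVK s A : s^-1%g @^-1: (s @^-1: A) = A.
Proof. by apply/setP => i; rewrite !inE permKV. Qed.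

Lemma pullK s f : pull s (pull s^-1 f) = f.
Proof. by apply/ffunP => A; rewrite !ffunE preimset_permVK. Qed.

Lemma pullVK s f : pull s^-1 (pull s f) = f.
Proof. by apply/ffunP => A; rewrite !ffunE preimset_permK. Qed.

Lemma pull_linear s f g (a : R) : pull s (f - a *: g) = pull s f - a *: pull s g.
Proof. by apply/ffunP => A; rewrite !ffunE. Qed.

Lemma pull_tight s f A B : tight (pull s f) A B <-> tight f (s @^-1: A) (s @^-1: B).
Proof. by rewrite /tight !ffunE preimsetU preimsetI. Qed.

Lemma pull_submodular s f : f \in @submodular R n -> pull s f \in @submodular R n.
Proof.
move=> /submodularP fS; apply/submodularP => A B.
by rewrite !ffunE preimsetU preimsetI.
Qed.

Lemma pull_modular s f : f \in @modular R n -> pull s f \in @modular R n.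
Proof. by move=> /modularP fM; apply/modularP => A B; apply/pull_tight/fM. Qed.

(** Tight pairs are permuted together with the ground set. *)
Lemma pull_spans_ray s f : spans_ray f -> spans_ray (pull s f).
Proof.
move=> [fS fM rf]; split; first exact: pull_submodular.
  by apply: contra fM => /(pull_modular s^-1); rewrite pullVK.
move=> g gt; have [|c gM] := rf (pull s^-1 g).
  by move=> A B fAB; apply/pull_tight/gt/pull_tight; rewrite !preimset_permK.
by exists c; rewrite -[g](pullK s) -pull_linear pull_modular.
Qed.

Lemma pull_separated s f (U : pred {set 'I_n}) i :
  separated (s^-1%g i) (fun A => U (s^-1%g @^-1: A)) f -> separated i U (pull s f).
Proof.
have E A : incr i (pull s f) A = incr (s^-1%g i) f (s @^-1: A).
  have e j : (s j == i) = (j == s^-1%g i) by rewrite -[RHS](inj_eq (@perm_inj _ s)) permKV.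
  by rewrite /incr !ffunE; congr (f _ - f _); apply/setP => j; rewrite !inE e.
move=> sf A; rewrite !E; have := sf (s @^-1: A).
rewrite preimset_permVK.
have [-> ->] : s @^-1: set0 = set0 /\ s @^-1: setT = setT.
  by split; apply/setP => j; rewrite !inE.
by [].
Qed.

End Pull.

(** * Set functions given by tables *)

Section Tables.
Local Open Scope ring_scope.
Variables (R : realType) (n : nat) (h : bitseq -> nat).
Implicit Types (A B : {set 'I_n}) (u v b c : bitseq) (i : 'I_n).

(** Tables hold natural numbers, so the function is the opposite of the
    tabulated one, which has to be supermodular. *)
Definition table_fun : set_fun R n := [ffun A : {set 'I_n} => - (h (bits A))%:R].

Definition supermodular_table :=
  all (fun u => all (fun v => h u + h v <= h (bor u v) + h (band u v))%N (cube n)) (cube n).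

Definition normalised_table :=
  all (fun b => (count id b <= 1)%N ==> (h b == 0)) (cube n) && (h (nseq n true) != 0).

(** The unknowns are the values of g - c f on all sets, where g is normalised
    and c makes the value at the full set vanish; unit rows say that the values
    at the empty set, singletons and the full set are zero, and square rows that
    g - c f is tight at a pair. *)
Definition unit_row c : seq int := [seq Posz (b == c) | b <- cube n].

Definition square_row u v : seq int :=
  [seq Posz ((b == u) + (b == v)) - Posz ((b == bor u v) + (b == band u v)) | b <- cube n].

(** Pairs A + i, A + j: they define the facets of the cone, all other
    inequalities being sums of these. *)
Definition tight_square (p : bitseq * bitseq) :=
  [&& count id (bdiff p.1 p.2) == 1, count id (bdiff p.2 p.1) == 1 &
      h p.1 + h p.2 == h (bor p.1 p.2) + h (band p.1 p.2)]%N.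

Definition rigid_table := only_zero_solution (size (cube n))
  ([seq unit_row c | c <- cube n & (count id c <= 1)%N || (c == nseq n true)] ++
   [seq square_row p.1 p.2 | p <- [seq (u, v) | u <- cube n, v <- cube n] & tight_square p]).

(** The sets e are singletons.  As a normalised table vanishes on them and on the
    empty set, the increment at the empty set is zero. *)
Definition separated_table k :=
  all (fun e => all (fun b =>
    if (k <= count id (bdiff b e))%N then h (bdiff b e) < h (bor e b)
    else h (bdiff (nseq n true) e) + h (bor e b) < h (nseq n true) + h (bdiff b e))%N
  (cube n)) [seq e <- cube n | count id e == 1].

Lemma table_funE A : table_fun A = - (h (bits A))%:R :> R.
Proof. by rewrite ffunE. Qed.

Lemma supermodular_tableP : supermodular_table -> table_fun \in @submodular R n.
Proof.
move=> hS; apply/submodularP => A B; rewrite !table_funE bitsU bitsI -!opprD lerN2 -!natrD ler_nat.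
exact: (all_cubeP (all_cubeP hS A) B).
Qed.

Hypothesis hN : normalised_table.

Lemma table_small A : (#|A| <= 1)%N -> h (bits A) = 0%N.
Proof.
have /andP[hs _] := hN; have := all_cubeP hs A; rewrite count_bits.
by move=> /implyP/[apply]/eqP.
Qed.

Lemma table_set0 : h (bits (set0 : {set 'I_n})) = 0%N.
Proof. by rewrite table_small// cards0. Qed.

Lemma table_set1 i : h (bits [set i]) = 0%N.
Proof. by rewrite table_small// cards1. Qed.

Lemma table_setT : h (bits [set: 'I_n]) != 0%N.
Proof. by rewrite bitsT; have /andP[] := hN. Qed.

Lemma separated_tableP k i : separated_table k ->
  separated i (fun A => k <= #|A :\ i|)%N table_fun.
Proof.
move=> hS A; rewrite /incr !table_funE setU0 set0D table_set0 table_set1.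
rewrite setUT !bitsU !bitsD bitsT.
have ei : bits [set i] \in [seq e <- cube n | count id e == 1%N].
  by rewrite mem_filter bits_cube count_bits cards1.
have := all_cubeP (allP hS _ ei) A; rewrite -bitsD count_bits.
case: ifP => _; rewrite bitsD -(ltr_nat R) ?natrD => ?; last lra.
by rewrite oppr0 subrr; lra.
Qed.

Lemma table_nonmodular : table_fun \notin @modular R n.
Proof.
apply/negP => /modular_eq0 f0; have := table_setT.
rewrite -(pnatr_eq0 R) -oppr_eq0 -table_funE f0 ?eqxx ?table_funE ?table_set0 ?oppr0//.
by move=> j; rewrite table_funE table_set1 oppr0.
Qed.

Lemma dot_map (F : bitseq -> int) (x : bitseq -> R) (bs : seq bitseq) :
  dot [seq F b | b <- bs] [seq x b | b <- bs] = \sum_(b <- bs) (F b)%:~R * x b.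
Proof. by rewrite /dot zip_map big_map. Qed.

Lemma sum_delta (x : bitseq -> R) c : c \in cube n ->
  \sum_(b <- cube n) (b == c)%:R * x b = x c.
Proof.
move=> cn; rewrite (bigD1_seq c) ?cube_uniq//= eqxx mul1r big1 ?addr0// => b /negbTE ->.
by rewrite mul0r.
Qed.

Lemma rigid_tableP : rigid_table -> rigid table_fun.
Proof.
move=> hR; apply: rigid_normalised => g g0 g1 gt.
pose c : R := g setT / table_fun setT; exists c.
have [x xE] : exists x : bitseq -> R, forall A, x (bits A) = g A - c * table_fun A.
  by exists (fun b => g (unbits n b) - c * table_fun (unbits n b)) => A; rewrite bitsK.
suff x0 b : b \in cube n -> x b = 0.
  by move=> A; apply/eqP; rewrite -subr_eq0 -xE x0// bits_cube.
move=> bn; apply: (only_zero_solutionP (x := map x (cube n)) hR); rewrite ?size_map//.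
- apply/allP => r; rewrite mem_cat => /orP[] /mapP[y _ ->]; by rewrite size_map.
- move=> r; rewrite mem_cat => /orP[] /mapP[].
    move=> y; rewrite mem_filter => /andP[ysmall yn] ->.
    rewrite dot_map sum_delta//; move: yn ysmall => /unbitsK <-; set A := unbits n y.
    rewrite count_bits xE -bitsT (can_eq (@bitsK n)) => /orP[Asmall|/eqP ->].
      rewrite table_funE table_small// oppr0 mulr0 subr0.
      move: Asmall; rewrite leq_eqVlt ltnS leqn0 cards_eq0.
      by case/orP => [/cards1P[j ->]|/eqP ->].
    rewrite /c divfK ?subrr// table_funE oppr_eq0 pnatr_eq0; exact: table_setT.
  move=> [u v]; rewrite mem_filter => /andP[/and3P[_ _ /eqP/= huv]].
  case/allpairsP => -[u' v'] [/= un vn [eu ev]] ->; rewrite dot_map.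
  move: un vn; rewrite -{u'}eu -{v'}ev => un vn.
  transitivity (x u + x v - (x (bor u v) + x (band u v))).
    move: un vn => /unbitsK <- /unbitsK <-; rewrite -bitsU -bitsI.
    rewrite -!(@sum_delta x) ?bits_cube// -!big_split -sumrB; apply: eq_bigr => d _.
    by rewrite rmorphB/= -!pmulrn !natrD; ring.
  move: un vn huv => /unbitsK <- /unbitsK <-; rewrite -bitsU -bitsI !xE => huv.
  set A := unbits n u; set B := unbits n v.
  have fAB : tight table_fun A B.
    by rewrite /tight !table_funE -!opprD -!natrD -huv.
  have gAB := gt _ _ fAB; rewrite /tight in fAB gAB.
  transitivity (g A + g B - (g (A :|: B) + g (A :&: B)) -
      c * (table_fun A + table_fun B - (table_fun (A :|: B) + table_fun (A :&: B)))).
    ring.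
  by rewrite gAB fAB !subrr mulr0 subr0.
- by apply: map_f.
Qed.

End Tables.

(** * Six rays on five elements *)

(** The entry of a set A has index the sum of 2^i over the elements i of A. *)
Definition lookup (tab : seq nat) (b : bitseq) : nat :=
  nth 0 tab (foldr (fun (x : bool) c => x + c.*2) 0 b).

(** Opposites of six rays of the cone for five elements, normalised to vanish on
    sets with at most one element and scaled to take the value 7 on the full
    set.  Among the rays with trivial stabiliser, they are chosen so that every
    increment attains its minimum only on sets with at least two elements and
    its maximum only on smaller sets. *)
Definition five_tables : seq (seq nat) :=
 [:: [:: 0; 0; 0; 0; 0; 1; 1; 2; 0; 1; 1; 2; 1; 2; 2; 4;
         0; 1; 1; 2; 1; 2; 3; 4; 2; 3; 3; 4; 3; 5; 5; 7];
     [:: 0; 0; 0; 0; 0; 0; 0; 1; 0; 0; 1; 2; 1; 2; 2; 4;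
         0; 0; 1; 2; 1; 2; 3; 4; 1; 2; 2; 4; 3; 4; 5; 7];
     [:: 0; 0; 0; 0; 0; 1; 1; 2; 0; 1; 1; 2; 1; 2; 2; 4;
         0; 1; 1; 2; 1; 2; 3; 4; 2; 3; 3; 4; 3; 4; 5; 7];
     [:: 0; 0; 0; 0; 0; 0; 0; 1; 0; 0; 0; 2; 1; 2; 2; 4;
         0; 0; 1; 2; 1; 2; 3; 4; 1; 2; 2; 4; 3; 4; 5; 7];
     [:: 0; 0; 0; 0; 0; 0; 1; 2; 0; 1; 1; 2; 1; 2; 2; 4;
         0; 1; 1; 2; 1; 2; 3; 4; 1; 2; 2; 4; 3; 4; 5; 7];
     [:: 0; 0; 0; 0; 0; 0; 0; 1; 0; 0; 0; 2; 1; 2; 2; 4;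
         0; 0; 1; 2; 1; 2; 3; 4; 1; 2; 2; 4; 2; 4; 5; 7]].

Definition five_table (k : nat) : bitseq -> nat := lookup (nth [::] five_tables k).

(** Two invariants show that the 720 images are distinct: [total] is constant on
    orbits and takes different values on the six rays, while the five weights of
    a ray are different and are permuted with the ground set. *)
Definition total (h : bitseq -> nat) : nat := sumn [seq h b | b <- cube 5].

Definition weight (h : bitseq -> nat) (i : nat) : nat :=
  sumn [seq if nth false b i then h b ^ 2 else 0 | b <- cube 5].

Lemma all_five_tables (P : (bitseq -> nat) -> bool) :
  all (fun t => P (lookup t)) five_tables -> forall k : 'I_6, P (five_table k).
Proof. by move=> PT k; apply: (all_nthP [::] PT). Qed.

Lemma total_injective : {in gtn 6 &, injective (fun k => total (five_table k))}.
Proof. by apply/mkseq_uniqP; vm_compute. Qed.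

Lemma weight_injective (k : 'I_6) : {in gtn 5 &, injective (weight (five_table k))}.
Proof.
apply/mkseq_uniqP; move: k.
by apply: (all_five_tables (P := fun h => uniq (mkseq (weight h) 5))); vm_compute.
Qed.

Section Five.
Local Open Scope ring_scope.
Variable R : realType.

Definition five_ray (ks : 'I_6 * 'S_5) : set_fun R 5 :=
  pull ks.2 (table_fun R 5 (five_table ks.1)).

Lemma five_normalised (k : 'I_6) : normalised_table 5 (five_table k).
Proof. by move: k; apply: (all_five_tables (P := normalised_table 5)); vm_compute. Qed.

Lemma five_ray_spans_ray ks : spans_ray (five_ray ks).
Proof.
case: ks => k s; apply: pull_spans_ray; split.
- apply: supermodular_tableP; move: k.
  by apply: (all_five_tables (P := supermodular_table 5)); vm_compute.
- exact/table_nonmodular/five_normalised.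
- apply: rigid_tableP (five_normalised k) _; move: k.
  by apply: (all_five_tables (P := rigid_table 5)); vm_compute.
Qed.

Lemma five_ray_separated ks (i : 'I_5) :
  separated i (fun A => 2 <= #|A :\ i|)%N (five_ray ks).
Proof.
case: ks => k s; apply: pull_separated => A /=.
have kS : separated_table 5 (five_table k) 2.
  by move: k; apply: (all_five_tables (P := fun h => separated_table 5 h 2)); vm_compute.
have := separated_tableP R (five_normalised k) (s^-1%g i) kS A.
have -> : (s^-1%g @^-1: A) :\ i = s^-1%g @^-1: (A :\ s^-1%g i).
  by apply/setP => j; rewrite !inE (inj_eq perm_inj).
by rewrite card_preimset//; exact: perm_inj.
Qed.

Lemma sum_pull (s : 'S_5) (F : {set 'I_5} -> nat) :
  (\sum_(A : {set _}) F (s @^-1: A) = \sum_A F A)%N.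
Proof.
rewrite [RHS](reindex (fun A : {set 'I_5} => s @^-1: A))//.
by exists (fun A : {set 'I_5} => s^-1%g @^-1: A) => A _; rewrite ?preimset_permK ?preimset_permVK.
Qed.

Lemma five_ray_injective ks lt (a : R) :
  five_ray ks - a *: five_ray lt \in @modular R 5 -> ks = lt.
Proof.
case: ks lt => [k s] [l t] klM.
have pre0 (u : 'S_5) : u @^-1: set0 = set0 by apply/setP => j; rewrite !inE.
have preT (u : 'S_5) : u @^-1: setT = setT by apply/setP => j; rewrite !inE.
have pre1 (u : 'S_5) j : u @^-1: [set j] = [set u^-1%g j].
  by apply/setP => x; rewrite !inE -[RHS](inj_eq (@perm_inj _ u)) permKV.
have fE := proportional_of_modular _ _ _ _ klM.
have {fE} : forall A, five_ray (k, s) A = a * five_ray (l, t) A.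
  by apply: fE => *; rewrite /five_ray ffunE ?pre0 ?pre1 table_funE
    ?table_set0 ?table_set1 ?oppr0 //; exact: five_normalised.
rewrite /five_ray/= => klE.
have hT : forall m : 'I_6, five_table m (bits [set: 'I_5]) = 7%N.
  move=> m; rewrite bitsT; apply/eqP; move: m.
  by apply: (all_five_tables (P := fun h => h (nseq 5 true) == 7%N)); vm_compute.
(* All six functions take the value -7 at the full set. *)
have a1 : a = 1.
  have := klE setT; rewrite !ffunE !preT !hT mulrN => /oppr_inj/eqP.
  by rewrite -{1}[7%:R]mul1r eq_sym => /eqP/mulIf; apply; rewrite pnatr_eq0.
have {klE} hE (A : {set 'I_5}) : five_table k (bits (s @^-1: A)) = five_table l (bits (t @^-1: A)).
  by have /eqP := klE A; rewrite a1 mul1r !ffunE eqr_opp eqr_nat => /eqP.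
have kl : k = l.
  apply/val_inj/total_injective; [exact: ltn_ord | exact: ltn_ord |].
  rewrite /total !sum_cube -[LHS](sum_pull s) -[RHS](sum_pull t).
  by apply: eq_bigr => A _; exact: hE.
subst l; congr pair; apply: invg_inj; apply/permP => i.
apply/val_inj/(@weight_injective k); [exact: ltn_ord | exact: ltn_ord |]; rewrite /weight !sum_cube -[LHS](sum_pull s) -[RHS](sum_pull t).
apply: eq_bigr => A _; rewrite hE !nth_bits !inE !permKV.
by [].
Qed.

Lemma five_gluable : gluable_rays R 5 656.
Proof.
exists ord0, (fun A => 2 <= #|A :\ ord0|)%N, _, five_ray; split.
- by rewrite card_prod card_ord card_Sn.
- exact: five_ray_spans_ray.
- by move=> ks; exact: five_ray_separated.
- exact: five_ray_injective.
Qed.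

End Five.

Theorem corollary3p20 (R : realType) :
  (forall n : nat, 4 <= n -> 11 ^ (2 ^ (n - 4)) <= num_rays R n) /\
  (forall n : nat, 5 <= n -> 656 ^ (2 ^ (n - 5)) <= num_rays R n).
Proof.
have five n : 5 <= n -> 656 ^ (2 ^ (n - 5)) <= num_rays R n.
  move=> n5; apply: gluable_rays_num; rewrite -{1}(subnK n5).
  exact/gluable_rays_iter/five_gluable.
split=> // n; rewrite leq_eqVlt => /orP[/eqP <-|n5].
  exact: leq_trans (num_rays_filters R 4).
apply: leq_trans (five n n5).
rewrite (_ : n - 4 = (n - 5).+1); last by rewrite -subSn.
by rewrite expnS expnM leq_exp2r ?expn_gt0.
Qed.
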